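(* Let $X$ be a Cantor set and $T\in Homeo(X)$. The topological full group $[[T]]$ of $T$ is $\tau$-dense in the full group $[T]_C$.
   Context: $X$ is a Cantor set and $\mathcal B$ its $\sigma$-algebra of Borel sets. $Aut(X,\mathcal B)$ is the group of all Borel bijections of $X$ onto itself, and $Homeo(X)$ is its subgroup of all homeomorphisms of $X$. For $S,T\in Aut(X,\mathcal B)$ put $E(S,T)=\{x\in X: Sx\ne Tx\}$. The uniform topology $\tau$ on $Aut(X,\mathcal B)$ has as a base the sets $$U(T;\mu_1,\ldots,\mu_n;\varepsilon)=\{S\in Aut(X,\mathcal B):\mu_i(E(S,T))<\varepsilon,\ i=1,\ldots,n\},$$ where $T\in Aut(X,\mathcal B)$, $\mu_1,\ldots,\mu_n$ are Borel probability measures on $X$, and $\varepsilon>0$. The induced topology on $Homeo(X)$ is also denoted $\tau$. For $T\in Homeo(X)$ let $Orb_T(x)=\{T^nx:n\in\mathbb Z\}$ and $[T]_C=\{S\in Homeo(X): Orb_S(x)\subseteq Orb_T(x)\text{ for all }x\in X\}$. The topological full group $[[T]]$ is the group of all $S\in[T]_C$ for which there is a continuous function $n_S:X\to\mathbb Z$ with $Sx=T^{n_S(x)}x$ for all $x\in X$. *)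

(* Defs.v *)
From HB Require Import structures.
From mathcomp Require Import all_boot all_order all_algebra.
From mathcomp Require Import finmap all_classical all_reals all_analysis.

Set Implicit Arguments.
Unset Strict Implicit.
Unset Printing Implicit Defensive.

Import Order.TTheory GRing.Theory Num.Theory.
Local Open Scope classical_set_scope.
Local Open Scope ring_scope.

Definition borel (X : ptopologicalType) := g_sigma_algebraType (@open X).

Lemma continuous_borel (X : ptopologicalType) (f : X -> X) : continuous f ->
  measurable_fun [set: borel X] (f : borel X -> borel X).
Proof.
move=> /continuousP cf.
apply: (@measurability _ _ (borel X) (borel X) _ _ (@open X)) => //.
move=> _ [U oU <-]; rewrite setTI.
by apply: sub_sigma_algebra; exact: cf.
Qed.

Record borel_aut (R : realType) (X : pseudoPMetricType R) := BorelAut {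
  baut_fun :> X -> X;
  baut_inv : X -> X;
  baut_funK : cancel baut_fun baut_inv;
  baut_invK : cancel baut_inv baut_fun;
  measurable_baut :
    measurable_fun [set: borel X] (baut_fun : borel X -> borel X);
  measurable_baut_inv :
    measurable_fun [set: borel X] (baut_inv : borel X -> borel X) }.

HB.instance Definition _ (R : realType) (X : pseudoPMetricType R) :=
  gen_eqMixin (borel_aut X).
HB.instance Definition _ (R : realType) (X : pseudoPMetricType R) :=
  gen_choiceMixin (borel_aut X).

Section uniform_topology.
Context {R : realType} {X : pseudoPMetricType R}.
Implicit Types S T : borel_aut X.

Definition disagree S T : set (borel X) := [set x | S x <> T x].

Definition uniform_nbhd T (mus : seq (probability (borel X) R)) (e : R) :
    set (borel_aut X) :=
  [set S | forall mu, mu \in mus -> (mu (disagree S T) < e%:E)%E].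

Definition uniform_base : set (set (borel_aut X)) :=
  [set U | exists T mus e, 0 < e /\ U = uniform_nbhd T mus e].

End uniform_topology.

(* The factory asks for a subbase only; the family is in fact a base when X is
   a Cantor set, see [uniform_base_basis] below. *)
HB.instance Definition _ (R : realType) (X : pseudoPMetricType R) :=
  isSubBaseTopological.Build (borel_aut X) (@uniform_base R X) id.

Section uniform_base_basis.
Context {R : realType} {X : pseudoPMetricType R} (cantorX : cantor_like X).
Implicit Types S T : borel_aut X.

(* The diagonal of X is Borel, being separated by countably many clopen sets. *)
Lemma measurable_disagree S T : measurable (disagree S T).
Proof.
have [_ cptX _ zdX] := cantorX.
pose U := unsquash (clopen_surj cptX).
have -> : disagree S T =
    \bigcup_n ((S @^-1` (U n)) `&` (T @^-1` (~` (U n)))).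
  apply/seteqP; split=> [x /= /eqP /zdX [V [cV VS VT]]|x /=].
    have [n _ UnV] : exists2 n, [set: nat] n & U n = V.
      by have /= := @surj _ _ _ _ U => /(_ V cV) [n nT UnV]; exists n.
    by exists n => //=; rewrite UnV.
  by move=> [n _ [/= US UT]] STx; apply: UT; rewrite /= -STx.
apply: (@bigcup_measurable _ (borel X)) => n _.
have mU : measurable (U n : set (borel X)).
  by apply: sub_sigma_algebra; have [] : clopen (U n) by exact: funS.
apply: measurableI.
  by rewrite -[X in measurable X]setTI; exact: (measurable_baut S).
rewrite -[X in measurable X]setTI; apply: (measurable_baut T) => //.
exact: measurableC.
Qed.

Lemma uniform_nbhd_refl T mus (e : R) : 0 < e -> uniform_nbhd T mus e T.
Proof.
move=> e0 mu _; suff -> : disagree T T = set0 by rewrite measure0 lte_fin.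
by apply/seteqP; split=> x //=; exact.
Qed.

Lemma uniform_nbhd_sub T mus (e : R) S : uniform_nbhd T mus e S ->
  exists2 d : R, 0 < d & uniform_nbhd S mus d `<=` uniform_nbhd T mus e.
Proof.
elim: mus => [|mu mus IH] US; first by exists 1 => // P _ mu; rewrite in_nil.
have {IH} [|d d0 dU] := IH.
  by move=> nu nus; apply: US; rewrite inE nus orbT.
have muS : (mu (disagree S T) < e%:E)%E by apply: US; rewrite inE eqxx.
have fS : mu (disagree S T) \is a fin_num.
  by apply: fin_num_measure; exact: measurable_disagree.
exists (Num.min d (e - fine (mu (disagree S T)))).
  by rewrite lt_min d0 subr_gt0 -lte_fin fineK.
move=> P UP nu; rewrite inE => /orP[/eqP ->|nus]; last first.
  apply: dU nus => nu' nus'; apply: (lt_le_trans (UP _ _)).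
    by rewrite inE nus' orbT.
  by rewrite lee_fin ge_min lexx.
have muP : (mu (disagree P S) < (e - fine (mu (disagree S T)))%:E)%E.
  apply: lt_le_trans (UP mu _) _; first by rewrite inE eqxx.
  by rewrite lee_fin ge_min lexx orbT.
have sub : disagree P T `<=` disagree P S `|` disagree S T.
  move=> x /= PT; have [PS|PS] := pselect (P x = S x); last by left.
  by right=> ST; apply: PT; rewrite PS.
apply: (@le_lt_trans _ _ (mu (disagree P S) + mu (disagree S T))%E).
  apply: (@le_trans _ _ (mu (disagree P S `|` disagree S T))).
    apply: le_measure; rewrite ?inE//; first exact: measurable_disagree.
    by apply: measurableU; exact: measurable_disagree.
  by apply: measureU2; exact: measurable_disagree.
by rewrite -lteBrDr// -(fineK fS) -EFinB.
Qed.

Lemma uniform_base_basis : basis (@uniform_base R X).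
Proof.
have openU U : uniform_base U -> open U.
  move=> bU; exists [set U]; last by rewrite bigcup_set1.
  move=> _ ->; exists [fset U]%fset; last by rewrite set_fset1 bigcap_set1.
  by move=> V; rewrite in_fset1 => /eqP ->; exact/mem_set.
split=> [U /openU//|S O].
rewrite /nbhs /= => -[_ [[B sB <-] [V BV VS] sO]].
have [F FD FV] := sB _ BV.
suff [mus [e [e0 eV]]] : exists mus, exists e : R, 0 < e /\
    uniform_nbhd S mus e `<=` V.
  exists (uniform_nbhd S mus e); last first.
    by move=> P /eV VP; apply: sO; exists V.
  by split; [exists S, mus, e|exact: uniform_nbhd_refl].
have FS U : U \in F -> uniform_base U /\ U S.
  by move=> UF; split; [exact/set_mem/FD|move: VS; rewrite -FV; exact].
rewrite -FV.
have {FS} : forall U, U \in (F : seq _) -> uniform_base U /\ U S by [].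
have -> : [set` F] = [set U | U \in (F : seq _)] by [].
elim: (F : seq _) => [_|U s IH FS].
  by exists [::], 1; split=> // P _ U; rewrite /= in_nil.
have {IH} [|mus [e [e0 es]]] := IH.
  by move=> W Ws; apply: FS; rewrite inE Ws orbT.
have [|bU US] := FS U; first by rewrite inE eqxx.
move: bU US => [T [nus [d [d0 UE]]]]; rewrite UE => /uniform_nbhd_sub[c c0 cU].
exists (mus ++ nus), (Num.min e c); split; first by rewrite lt_min e0.
move=> P UP W; rewrite /= inE => /orP[/eqP->|Ws].
  apply: cU => nu nnu; apply: lt_le_trans (UP nu _) _.
    by rewrite mem_cat nnu orbT.
  by rewrite lee_fin ge_min lexx orbT.
apply: es Ws => nu nnu; apply: lt_le_trans (UP nu _) _.
  by rewrite mem_cat nnu.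
by rewrite lee_fin ge_min lexx.
Qed.

End uniform_base_basis.

(* The sets below are used as types: [set_type A] carries the topology induced
   from the ambient space. *)
Section full_groups.
Context {R : realType} {X : pseudoPMetricType R}.

Definition homeo : set (borel_aut X) :=
  [set S : borel_aut X | continuous S /\ continuous (baut_inv S)].

(* Every homeomorphism f of X, with inverse g, occurs in [homeo]. *)
Definition baut_of_homeo (f g : X -> X) (fK : cancel f g) (gK : cancel g f)
    (cf : continuous f) (cg : continuous g) : borel_aut X :=
  BorelAut fK gK (continuous_borel cf) (continuous_borel cg).

Definition iterz (T : borel_aut X) (n : int) : X -> X :=
  match n with
  | Posz k => iter k T
  | Negz k => iter k.+1 (baut_inv T)
  end.

Definition baut_orbit (T : borel_aut X) (x : X) : set X :=
  [set iterz T n x | n in [set: int]].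

Definition full_group (T : homeo) : set homeo :=
  [set S | forall x,
    baut_orbit (set_val S) x `<=` baut_orbit (set_val T) x].

Definition topological_full_group (T : homeo) : set homeo :=
  [set S | full_group T S /\
    exists n : X -> discrete_topology int,
      continuous n /\ forall x, set_val S x = iterz (set_val T) (n x) x].

End full_groups.

Arguments homeo {R} X.

(* Main.v *)
Require Import Defs.
From mathcomp Require Import all_boot all_order all_algebra.
From mathcomp Require Import all_classical all_reals all_analysis.
From mathcomp Require Import ring lra.

Set Implicit Arguments.
Unset Strict Implicit.
Unset Printing Implicit Defensive.
Import Order.TTheory GRing.Theory Num.Theory.

Local Open Scope classical_set_scope.
Local Open Scope ring_scope.

(** Let S be a homeomorphism of the Cantor set X that maps each point into its
T-orbit, and let nu be the sum of the finitely many probability measures that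
define a neighbourhood of S. It suffices to find s in the topological full
group [[T]] such that s o S is the identity off a set of nu-measure less than
d: then the inverse of s, which is again in [[T]], agrees with S there.

Such an s is built as a product of involutions. If U is clopen and disjoint from
its image under T^n, then exchanging U and T^n U by T^n, with the identity
elsewhere, is an element of [[T]] ([in_tfg_swap]). Let g be any homeomorphism
mapping points into their T-orbits, and A a clopen set disjoint from g(A). The
closed set of the x in A with g x = T^n x is the intersection of a decreasing
sequence of clopen sets U; composing g with the exchange of U and T^n U turns
these x into fixed points, creates no new moved point, and leaves g unchanged on
A up to a set whose measure tends to 0 as U shrinks ([swap_step]). As every x in
A satisfies g x = T^n x for some n, finitely many such steps make g the identity
on A up to a set of small measure ([undo_on_clopen]).

Moreover A can be chosen to contain almost a quarter of the mass of the set E of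
points moved by g. Indeed finitely many clopen sets separate x from g x for most
x in E, and among the sums modulo 2 of those clopen sets some v separates x from
g x on at least half of that part of E ([half_split]); now take for A either
the x in v with g x not in v, or the x not in v with g x in v. Hence there is
s in [[T]] such that s o g moves a set of mass at most 3/4 nu(E) + d
([shrink_unfixed]). Consequently the infimum over s in [[T]] of the mass of the
points moved by s o S is 0 ([approx_by_tfg]). *)

(** * Homeomorphisms and locally constant functions *)

Section homeomorphisms.
Context {X : topologicalType}.
Implicit Types g h : X -> X.

(** [g] is a homeomorphism with inverse [g']. *)
Definition homeo_pair g g' :=
  [/\ cancel g g', cancel g' g, continuous g & continuous g'].

Lemma homeo_pair_id : homeo_pair id id.
Proof. by split=> // x; exact: cvg_id. Qed.

Lemma homeo_pairV g g' : homeo_pair g g' -> homeo_pair g' g.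
Proof. by case. Qed.

Lemma homeo_pair_comp g g' h h' : homeo_pair g g' -> homeo_pair h h' ->
  homeo_pair (g \o h) (h' \o g').
Proof.
move=> [gK gK' cg cg'] [hK hK' ch ch']; split.
- exact: can_comp.
- exact: can_comp.
- by move=> x; apply: continuous_comp; [exact: ch|exact: cg].
- by move=> x; apply: continuous_comp; [exact: cg'|exact: ch'].
Qed.

Lemma clopen_near (U : set X) x : clopen U ->
  \forall y \near x, (y \in U) = (x \in U).
Proof.
move=> [oU cU]; have [/set_mem xU|/negP xU] := boolP (x \in U).
  by have := open_nbhs_nbhs (conj oU xU); apply: filterS => y /mem_set.
have /open_nbhs_nbhs : open_nbhs x (~` U).
  by split; [exact: closed_openC|move/mem_set].
by apply: filterS => y /= yU; exact/memNset.
Qed.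

Lemma continuous_discreteP (Y : choiceType) (n : X -> discrete_topology Y) :
  continuous n <-> forall x, \forall y \near x, n y = n x.
Proof. by split=> cn x; [have /discrete_cvg := cn x|apply/discrete_cvg/cn]. Qed.

End homeomorphisms.

(** * Powers of T and the topological full group *)

Section iterates.
Context {R : realType} {X : pseudoPMetricType R} (T : borel_aut X).

Lemma iterzS n x : iterz T (n + 1) x = T (iterz T n x).
Proof.
case: n => [n|[|n]]; first by rewrite addrC -intS.
  by rewrite NegzE addNr /= baut_invK.
have -> : Negz n.+1 + 1 = Negz n.
  by rewrite !NegzE [n.+2%:Z]intS opprD addrAC addNr add0r.
by rewrite /= baut_invK.
Qed.

Lemma iterzN1 n x : iterz T (n - 1) x = baut_inv T (iterz T n x).
Proof. by rewrite -[n in RHS](subrK 1) iterzS baut_funK. Qed.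

Lemma iterzD m n x : iterz T (m + n) x = iterz T m (iterz T n x).
Proof.
elim/int_ind: m => [|m IH|m IH]; first by rewrite add0r.
  by rewrite intS [1 + _]addrC addrAC !iterzS IH.
by rewrite intS opprD [-1 - _]addrC addrAC !iterzN1 IH.
Qed.

Lemma iterzK n : cancel (iterz T n) (iterz T (- n)).
Proof. by move=> x; rewrite -iterzD addNr. Qed.

Lemma iterzNK n : cancel (iterz T (- n)) (iterz T n).
Proof. by move=> x; rewrite -iterzD subrr. Qed.

Context (homT : homeo_pair T (baut_inv T)).

Lemma homeo_iterz n : homeo_pair (iterz T n) (iterz T (- n)).
Proof.
have [_ _ cT cT'] := homT.
suff H m : continuous (iterz T m).
  by split; [exact: iterzK|exact: iterzNK|exact: H|exact: H].
elim/int_ind: m => [|m IH|m IH]; first by move=> x; exact: cvg_id.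
  by move=> x; rewrite (_ : iterz _ _ = T \o iterz T m)//;
    apply: continuous_comp; [exact: IH|exact: cT].
move=> x; rewrite (_ : iterz _ _ = baut_inv T \o iterz T (- m%:Z)); last first.
  by apply/funext=> y; rewrite intS opprD addrC iterzN1.
by apply: continuous_comp; [exact: IH|exact: cT'].
Qed.

(** Membership in the topological full group of [T], for plain maps: [s] is a
homeomorphism of the form x |-> T^(n x) x, with [n] locally constant. *)
Definition in_tfg (s : X -> X) := exists (s' : X -> X) (n : X -> int),
  [/\ homeo_pair s s', forall x, \forall y \near x, n y = n x &
      forall x, s x = iterz T (n x) x].

Lemma in_tfg_id : in_tfg id.
Proof.
exists id, (fun=> 0); split=> //; first exact: homeo_pair_id.
by move=> x; exact: nearW.
Qed.

Lemma in_tfg_comp s t : in_tfg s -> in_tfg t -> in_tfg (s \o t).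
Proof.
move=> [s' [n [hs ln sn]]] [t' [m [ht lm tm]]].
exists (t' \o s'), (fun x => n (t x) + m x); split.
- exact: homeo_pair_comp.
- move=> x; have [_ _ ct _] := ht; have /= := ct x _ (ln (t x)).
  rewrite /nbhs /= => lnt.
  by near=> y; congr (_ + _); near: y; [exact: lnt|exact: lm].
- by move=> x; rewrite iterzD -tm -sn.
Unshelve. all: by end_near. Qed.

Lemma in_tfg_inv s s' : in_tfg s -> cancel s s' -> in_tfg s'.
Proof.
move=> [s'' [n [hs ln sn]]] sK; have [_ sK' cs cs'] := hs.
have -> : s' = s'' by apply/funext => x; rewrite -{1}(sK' x) sK.
exists s, (fun x => - n (s'' x)); split; first exact: homeo_pairV.
  move=> x; have := cs' x [set y | n y = n (s'' x)] (ln (s'' x)).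
  by rewrite nbhs_simpl /=; apply: filterS => y /= ->.
by move=> x; rewrite -[X in iterz _ _ X](sK' x) [s (s'' x)]sn iterzK.
Qed.

(** The exponent of [T] in the involution exchanging [U] and its image under
T^n; the two sets are meant to be disjoint. *)
Definition swap_cocycle (U : set X) n x :=
  if x \in U then n else if iterz T (- n) x \in U then - n else 0.

(** The map [s] is the involution exchanging [U] and T^n U along T^n. *)
Lemma in_tfg_swap U n : clopen U ->
  (forall x, U x -> ~ U (iterz T n x)) ->
  exists s, [/\ in_tfg s,
    forall x, U x -> s (iterz T n x) = x &
    forall x, ~ U x -> ~ U (iterz T (- n) x) -> s x = x].
Proof.
move=> cU UT.
pose m := swap_cocycle U n.
pose s x := iterz T (m x) x.
have sU x : U x -> s x = iterz T n x.
  by move=> Ux; rewrite /s /m /swap_cocycle mem_set.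
have sTU x : U x -> s (iterz T n x) = x.
  move=> Ux; rewrite /s /m /swap_cocycle memNset ?iterzK//; last exact: UT.
  by rewrite mem_set// iterzK.
have sN x : ~ U x -> ~ U (iterz T (- n) x) -> s x = x.
  by move=> Ux UTx; rewrite /s /m /swap_cocycle !memNset.
have ss : cancel s s.
  move=> x; have [Ux|Ux] := pselect (U x); first by rewrite (sU _ Ux) sTU.
  have [UTx|UTx] := pselect (U (iterz T (- n) x)); last by rewrite !sN.
  by have := sTU _ UTx; rewrite iterzNK => ->; rewrite sU// iterzNK.
have lm x : \forall y \near x, m y = m x.
  have cUT : clopen (iterz T (- n) @^-1` U).
    by apply: preimage_clopen => //; have [] := homeo_iterz (- n).
  rewrite /m /swap_cocycle; near=> y.
  have -> : (y \in U) = (x \in U) by near: y; exact: clopen_near.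
  suff -> : (iterz T (- n) y \in U) = (iterz T (- n) x \in U) by [].
  by near: y; exact: clopen_near cUT.
have cs : continuous s.
  move=> x; have [_ _ c _] := homeo_iterz (m x).
  have e : {near x, iterz T (m x) =1 s}.
    by apply: filterS (lm x) => y; rewrite /s => ->.
  exact: cvg_trans (near_eq_cvg e) (c x).
by exists s; split=> //; exists s, m.
Unshelve. all: by end_near. Qed.

End iterates.

(** * Clopen approximation of agreement sets *)

(** The topology of X is used only through a sequence [V] of clopen sets that
separates points. *)
Section separation.
Context {R : realType} {X : pseudoPMetricType R}.
Context (V : nat -> set X) (clopenV : forall i, clopen (V i)).
Context (sepV : forall x y, (forall i, V i x <-> V i y) -> x = y).
Implicit Types (f g : X -> X) (A B E U : set X).

Local Notation Borel A := (measurable (A : set (borel X))).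

(** The set on which [f] and [g] coincide. *)
Definition agree f g : set X := [set x | f x = g x].

(** The points whose images under [f] and [g] are not separated by
V_0, ..., V_(k-1): a decreasing sequence of sets, clopen for continuous [f] and
[g], with intersection [agree f g]. *)
Fixpoint nagree f g k : set X := if k is k.+1 then
  nagree f g k `&` [set x | V k (f x) <-> V k (g x)] else setT.

Lemma clopen_iff A B : clopen A -> clopen B -> clopen [set x | A x <-> B x].
Proof.
move=> cA cB; have -> : [set x | A x <-> B x] = (A `&` B) `|` (~` A `&` ~` B).
  apply/seteqP; split=> x /=; last by tauto.
  by have [|] := pselect (A x); tauto.
by apply: clopenU; apply: clopenI => //; exact: (@clopenC _ _ set0).
Qed.

Lemma clopen_nagree f g k : continuous f -> continuous g ->
  clopen (nagree f g k).
Proof.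
move=> cf cg; elim: k => [|k IH] /=; first exact: clopenT.
by apply: clopenI => //; apply: clopen_iff;
  [exact: (preimage_clopen (clopenV k) cf)
  |exact: (preimage_clopen (clopenV k) cg)].
Qed.

Lemma nagreeP f g k x :
  nagree f g k x <-> forall i, (i < k)%N -> (V i (f x) <-> V i (g x)).
Proof.
elim: k => [|k IH] //=; split=> [[/IH H Hk] i|H].
  by rewrite ltnS leq_eqVlt => /orP[/eqP->|/H].
by split; [apply/IH => i /ltnW ik; exact: H|exact: H].
Qed.

Lemma nagree_le f g k l : (k <= l)%N -> nagree f g l `<=` nagree f g k.
Proof.
by move=> kl x /nagreeP H; apply/nagreeP => i ik; apply/H/(leq_trans ik).
Qed.

Lemma agree_nagree f g k : agree f g `<=` nagree f g k.
Proof. by move=> x; rewrite /agree /= => e; apply/nagreeP => i _; rewrite e. Qed.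

Lemma bigcap_nagree f g : \bigcap_k nagree f g k = agree f g.
Proof.
apply/seteqP; split=> [x H|x fg k _]; last exact: agree_nagree.
apply: sepV => i; have /nagreeP := H i.+1 I; exact.
Qed.

Lemma measurable_clopen U : clopen U -> Borel U.
Proof. by move=> [oU _]; exact: sub_sigma_algebra. Qed.

Lemma measurable_agree f g : continuous f -> continuous g -> Borel (agree f g).
Proof.
move=> cf cg; rewrite -bigcap_nagree; apply: (@bigcap_measurable _ (borel X)).
  by exists 0%N.
by move=> k _; apply: measurable_clopen; exact: clopen_nagree.
Qed.

(** * Real-valued mass of a finite measure *)

Context (nu : {measure set (borel X) -> \bar R}) (nuT : (nu setT < +oo)%E).

Let mass A : R := fine (nu A).

Lemma nu_fin A : Borel A -> nu A \is a fin_num.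
Proof.
move=> mA; rewrite ge0_fin_numE//; apply: le_lt_trans nuT.
by apply: le_measure => //; rewrite ?inE.
Qed.

Lemma mass_ge0 A : 0 <= mass A. Proof. exact/fine_ge0. Qed.

Lemma mass_le A B : Borel A -> Borel B -> A `<=` B -> mass A <= mass B.
Proof.
move=> mA mB AB; apply: fine_le; [exact: nu_fin|exact: nu_fin|].
by apply: le_measure => //; rewrite ?inE.
Qed.

Lemma mass_split A B : Borel A -> Borel B ->
  mass A = mass (A `&` B) + mass (A `\` B).
Proof.
move=> mA mB; rewrite /mass -fineD ?nu_fin//.
- by rewrite measureD// -?ge0_fin_numE// ?nu_fin// addeC subeK// nu_fin//;
    exact: measurableI.
- exact: measurableI.
- exact: measurableD.
Qed.

Lemma mass_setU A B : Borel A -> Borel B -> mass (A `|` B) <= mass A + mass B.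
Proof.
move=> mA mB; rewrite /mass -fineD ?nu_fin//.
apply: fine_le; rewrite ?fin_numD ?nu_fin//; first exact: measurableU.
exact: measureU2.
Qed.

Lemma mass_vanish (F : nat -> set X) (d : R) : 0 < d -> (forall k, Borel (F k)) ->
  {homo F : k l / (k <= l)%N >-> l `<=` k} -> \bigcap_k F k = set0 ->
  exists k, mass (F k) <= d.
Proof.
move=> d0 mF decF F0.
have : (nu \o F) x @[x --> \oo] --> nu (\bigcap_n F n).
  apply: nonincreasing_cvg_mu => //.
  - by rewrite -ge0_fin_numE// nu_fin.
  - by rewrite F0.
  - by move=> k l kl; apply/subsetPset/decF.
rewrite F0 measure0 => /fine_cvgP[_ /cvgrPdist_le/(_ _ d0)[k _ Hk]].
exists k; have := Hk k (leqnn k).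
by rewrite /= sub0r normrN; apply: le_trans; exact: ler_norm.
Qed.

(** * A clopen set separating half of the moved points *)

(** The points that [v] separates from their image under [f]. *)
Definition split_by f (v : set X) : set X := [set x | ~ (v x <-> v (f x))].

Lemma clopen_split_by f v : continuous f -> clopen v -> clopen (split_by f v).
Proof.
move=> cf cv; apply: (@clopenC _ _ set0); apply: clopen_iff => //.
exact: (preimage_clopen cv cf).
Qed.

(** The induction allows [E] to be arbitrary: the part of [E] not split by V_k is
handled by induction, and adding V_k modulo 2 to the set [v] so obtained does
not change the points of that part which are split, while on the rest of [E] it
exchanges the points that are split and those that are not. *)
Lemma half_split f k E : continuous f -> Borel E ->
    E `<=` ~` nagree id f k ->
  exists2 v, clopen v & mass E <= 2 * mass (E `&` split_by f v).
Proof.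
move=> cf; elim: k E => [|k IH] E mE Ek.
  exists set0; first exact: clopen0.
  have -> : E = set0 by apply/seteqP; split=> // x /Ek /=.
  by rewrite set0I /mass measure0 /= mulr0.
pose D := split_by f (V k).
have mD : Borel D by apply: measurable_clopen; exact: clopen_split_by.
have mED : Borel (E `\` D) by exact: measurableD.
have [|v cv Ev] := IH _ mED.
  move=> x [Ex Dx] fx; apply: (Ek _ Ex); split=> //=.
  by apply: contrapT; exact: Dx.
pose v' := [set x | ~ (v x <-> V k x)].
have cv' : clopen v' by apply: (@clopenC _ _ set0); exact: clopen_iff.
have mv w : clopen w -> Borel (split_by f w).
  by move=> cw; apply: measurable_clopen; exact: clopen_split_by.
have e1 : (E `\` D) `&` split_by f v = (E `\` D) `&` split_by f v'.
  apply/seteqP; split=> x [[Ex Dx] H]; split=> //;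
    move: Dx H; rewrite /D /split_by /v' /=;
    have [|] := pselect (v x); have [|] := pselect (v (f x));
    have [|] := pselect (V k x); have [|] := pselect (V k (f x)); tauto.
have e2 : (E `&` D) `\` split_by f v = E `&` D `&` split_by f v'.
  apply/seteqP; split=> x [[Ex Dx] H]; split=> //;
    move: Dx H; rewrite /D /split_by /v' /=;
    have [|] := pselect (v x); have [|] := pselect (v (f x));
    have [|] := pselect (V k x); have [|] := pselect (V k (f x)); tauto.
have mE' : Borel (E `&` D) by exact: measurableI.
have spl w : clopen w -> mass (E `&` split_by f w) =
    mass (E `&` D `&` split_by f w) + mass ((E `\` D) `&` split_by f w).
  move=> cw; rewrite (@mass_split (E `&` _) D)//; last first.
    by apply: measurableI => //; exact: mv.
  by rewrite setIAC setIDAC setIDA.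
have := mass_split mE mD; have := mass_split mE' (mv _ cv); rewrite e2.
have := spl _ cv; have := spl _ cv'; rewrite -e1.
have [H|H] := leP (mass (E `&` split_by f v)) (mass (E `&` split_by f v')) =>
  s1 s2 s3 s4.
  by exists v' => //; lra.
by exists v => //; lra.
Qed.

(** * Undoing a homeomorphism by exchanges *)

Context (T : borel_aut X) (homT : homeo_pair T (baut_inv T)).

(** One exchange [s] turns into fixed points of s o g the points of [A] at which
[g] agrees with T^n, keeps the old fixed points, and does not change [g] on a
clopen part [B] of [A] which, up to mass [d], contains the other points of
[A]. *)
Lemma swap_step g g' n A (d : R) : homeo_pair g g' -> clopen A ->
    (forall x, A x -> ~ A (g x)) -> 0 < d ->
  exists s B, [/\ in_tfg T s, clopen B /\ B `<=` A,
    forall x, B x -> s (g x) = g x,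
    forall x, g x = x \/ A x /\ g x = iterz T n x -> s (g x) = x &
    mass (A `\` B `\` agree g (iterz T n)) <= d].
Proof.
move=> [gK g'K cg cg'] cA AgA d0.
have [_ _ cTn cTn'] := homeo_iterz homT n.
(* The second condition says that T^n maps U k into g(A), hence off A. *)
pose U k := A `&` (iterz T n @^-1` (g' @^-1` A)) `&` nagree g (iterz T n) k.
(* P k is the part of A that g maps into the image of U k under T^n. *)
pose P k := A `&` (g @^-1` (iterz T (- n) @^-1` U k)).
have cU k : clopen (U k).
  apply: clopenI; last exact: clopen_nagree.
  by apply: clopenI => //; do 2 apply: preimage_clopen => //.
have cP k : clopen (P k).
  by apply: clopenI => //; do 2 apply: preimage_clopen => //.
have UA k x : U k x -> A x by move=> [[]].
have Ug' k x : U k x -> A (g' (iterz T n x)) by move=> [[]].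
have [k mk] : exists k, mass (P k `\` agree g (iterz T n)) <= d.
  apply: mass_vanish => //.
  - move=> k; apply: (@measurableD _ (borel X)); first exact: measurable_clopen.
    exact: measurable_agree.
  - move=> k l kl x [[Ax [UTx]] agx] nag; do 2?split=> //.
    by split=> //; exact: nagree_le kl _ agx.
  - apply/seteqP; split=> // x PN; have [_] := PN 0%N I; apply.
    have Px k : P k x by have [] := PN k I.
    pose y := iterz T (- n) (g x).
    have yE : iterz T n y = g x by rewrite /y iterzNK.
    have : agree g (iterz T n) y.
      by rewrite -bigcap_nagree => k _; have [_ []] := Px k.
    rewrite /agree /= yE => /(can_inj gK) yx.
    by rewrite -yE yx.
have UTU x : U k x -> ~ U k (iterz T n x).
  by move=> /Ug' /AgA; rewrite g'K => nA /UA.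
have [s [sT sU sN]] := in_tfg_swap homT (cU k) UTU.
have cB : clopen (A `\` P k).
  by rewrite setDE; apply: clopenI => //; exact: (@clopenC _ _ set0).
exists s, (A `\` P k); split=> //.
- move=> x [Ax Px]; apply: sN => [/UA|Ux]; first exact: AgA.
  by apply: Px; split.
- move=> x [gx|[Ax gx]].
    have Ax : ~ A x by move=> Ax; apply: (AgA _ Ax); rewrite gx.
    rewrite gx sN// => [/UA//|/Ug'].
    by rewrite iterzNK -{1}gx gK.
  rewrite gx sU//; split; last exact: agree_nagree.
  by split=> //=; rewrite -gx gK.
- by rewrite setDD [A `&` P k](_ : _ = P k)//; apply/seteqP; split=> x [] // ? [].
Qed.

Context (e : nat -> int).

(** The points that [g] moves by one of the first [k] powers of [T] in the
enumeration [e] of exponents. *)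
Definition reach g k : set X :=
  [set x | exists2 i, (i < k)%N & g x = iterz T (e i) x].

Lemma measurable_reach g k : continuous g -> Borel (reach g k).
Proof.
move=> cg; have -> : reach g k = \bigcup_(i in [set i | (i < k)%N])
    agree g (iterz T (e i)).
  by apply/seteqP; split=> x [i ik gx]; exists i.
apply: (@bigcup_measurable _ (borel X)) => i _; apply: measurable_agree => //.
by have [] := homeo_iterz homT (e i).
Qed.

(** Induction on [k]: an exchange deals with the exponent [e k], and the smaller
ones are dealt with on the clopen set where that exchange had no effect. *)
Lemma undo_on_clopen k g g' A (d : R) : homeo_pair g g' -> clopen A ->
    (forall x, A x -> ~ A (g x)) -> 0 < d ->
  exists s, [/\ in_tfg T s, forall x, g x = x -> s (g x) = x &
    mass (A `&` reach g k `\` agree (s \o g) id) <= d].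
Proof.
elim: k g g' A d => [|k IH] g g' A d hg cA AgA d0.
  exists id; split=> //; first exact: in_tfg_id.
  rewrite [X in mass X](_ : _ = set0); first by rewrite /mass measure0 ltW.
  by apply/seteqP; split=> // x [[_ []]].
have d20 : 0 < d / 2 by lra.
have [s1 [B [s1T [cB BA] s1B s1x m1]]] := swap_step (e k) hg cA AgA d20.
have [s1' [n1 [hs1 _ _]]] := s1T.
have hg1 := homeo_pair_comp hs1 hg.
have BgB x : B x -> ~ B ((s1 \o g) x).
  by move=> Bx; rewrite /= s1B// => /BA; apply/AgA/BA.
have [s2 [s2T s2x m2]] := IH _ _ _ _ hg1 cB BgB d20.
have [s2' [n2 [hs2 _ _]]] := s2T.
exists (s2 \o s1); split; first exact: in_tfg_comp.
  by move=> x gx; apply: s2x; apply: s1x; left.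
have [_ _ cg _] := hg; have [_ _ cg1 _] := hg1.
have [_ _ cg2 _] := homeo_pair_comp hs2 hg1.
have mB := measurable_clopen cB; have mA := measurable_clopen cA.
have mF : Borel (agree (s2 \o s1 \o g) id).
  by apply: measurable_agree => // x; exact: cvg_id.
have mX : Borel (B `&` reach (s1 \o g) k `\` agree (s2 \o s1 \o g) id).
  apply: measurableD => //; apply: measurableI => //; exact: measurable_reach.
have mY : Borel (A `\` B `\` agree g (iterz T (e k))).
  apply: measurableD; first exact: measurableD.
  by apply: measurable_agree => //; have [] := homeo_iterz homT (e k).
rewrite (splitr d); apply: le_trans (lerD m2 m1).
apply: le_trans (mass_setU mX mY); apply: mass_le; last 1 first.
- move=> x [[Ax [i ik gx]] nF].
  have gek : g x <> iterz T (e k) x.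
    by move=> gek; apply: nF; apply: s2x; apply: s1x; right.
  have {}ik : (i < k)%N.
    by move: ik; rewrite ltnS leq_eqVlt => /orP[/eqP ik|//]; rewrite ik in gx.
  have [Bx|Bx] := pselect (B x); last by right.
  by left; split=> //; split=> //; exists i => //=; rewrite s1B.
- apply: measurableD => //; apply: measurableI => //; exact: measurable_reach.
- exact: measurableU.
Qed.

(** Composing with a suitable element of the topological full group multiplies the
mass of the set of moved points by at most 3/4, up to an arbitrarily small
error. *)
Lemma shrink_unfixed g g' (d : R) : homeo_pair g g' ->
    (forall x, exists i, g x = iterz T (e i) x) -> 0 < d ->
  exists2 s, in_tfg T s &
    mass (~` agree (s \o g) id) <= 3 / 4 * mass (~` agree g id) + d.
Proof.
move=> hg orbg d0; have [_ _ cg _] := hg.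
have cid : continuous (@id X) by move=> x; exact: cvg_id.
have d30 : 0 < d / 3 by lra.
pose E := ~` agree g id.
have mE : Borel E by apply: measurableC; exact: measurable_agree.
have mN k : Borel (nagree id g k).
  by apply: measurable_clopen; exact: clopen_nagree.
have [k mk] : exists k, mass (E `&` nagree id g k) <= d / 3.
  apply: mass_vanish => //.
  - by move=> k; exact: measurableI.
  - by move=> k l kl x [Ex Nx]; split=> //; exact: nagree_le kl _ Nx.
  - apply/seteqP; split=> // x Nx; have [Ex _] := Nx 0%N I; apply: Ex.
    have : agree id g x by rewrite -bigcap_nagree => k _; have [] := Nx k I.
    exact: esym.
have mEk : Borel (E `\` nagree id g k) by exact: measurableD.
have [v cv Ev] := half_split cg mEk (fun x Ex => Ex.2).
have cgv : clopen (g @^-1` v) by exact: preimage_clopen.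
have cC w : clopen w -> clopen (~` w) by exact: (@clopenC _ _ set0).
have [A [cA AgA EA]] : exists A, [/\ clopen A, forall x, A x -> ~ A (g x) &
    mass E <= 4 * mass A + d / 3].
  pose A1 := v `&` ~` (g @^-1` v); pose A2 := ~` v `&` (g @^-1` v).
  have cA1 : clopen A1 by apply: clopenI => //; exact: cC.
  have cA2 : clopen A2 by apply: clopenI => //; exact: cC.
  have mA12 : mass (split_by g v) <= mass A1 + mass A2.
    apply: le_trans (mass_setU (measurable_clopen cA1) (measurable_clopen cA2)).
    apply: mass_le.
    - by apply: measurable_clopen; exact: clopen_split_by.
    - by apply: measurable_clopen; exact: clopenU.
    - move=> x; rewrite /split_by /A1 /A2 /=.
      by have [|] := pselect (v x); have [|] := pselect (v (g x)); tauto.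
  have mEv : mass ((E `\` nagree id g k) `&` split_by g v) <=
      mass (split_by g v).
    have ms : Borel (split_by g v).
      by apply: measurable_clopen; exact: clopen_split_by.
    by apply: mass_le => //; exact: measurableI.
  have := mass_split mE (mN k).
  have [H|H] := leP (mass A1) (mass A2) => ?.
    by exists A2; split=> [//|x [nv vg] []//|]; lra.
  by exists A1; split=> [//|x [nv vg] []//|]; lra.
have mA := measurable_clopen cA.
have mR l : Borel (reach g l) by exact: measurable_reach.
have [l ml] : exists l, mass (A `\` reach g l) <= d / 3.
  apply: mass_vanish => //.
  - by move=> l; exact: measurableD.
  - move=> k' l kl x [Ax nR]; split=> // -[i ik gx]; apply: nR; exists i => //.
    exact: leq_trans ik kl.
  - apply/seteqP; split=> // x Nx; have [i gx] := orbg x.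
    by have [_ ] := Nx i.+1 I; apply; exists i.
have [s [sT sx ms]] := undo_on_clopen l hg cA AgA d30.
have [s' [n [hs _ _]]] := sT.
exists s => //.
have [_ _ csg _] := homeo_pair_comp hs hg.
have mF : Borel (agree (s \o g) id) by exact: measurable_agree.
have AE : A `<=` E by move=> x Ax gx; apply: (AgA _ Ax); rewrite gx.
have mEA : mass E = mass A + mass (E `\` A).
  by rewrite (mass_split mE mA) (_ : E `&` A = A)//; apply/setIidPr.
have mX : Borel (A `&` reach g l `\` agree (s \o g) id).
  by apply: measurableD => //; exact: measurableI.
have mY : Borel (A `\` reach g l) by exact: measurableD.
have mZ : Borel (E `\` A) by exact: measurableD.
have : mass (~` agree (s \o g) id) <= mass ((E `\` A) `|` ((A `\` reach g l) `|`
    (A `&` reach g l `\` agree (s \o g) id))).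
  apply: mass_le.
  - exact: measurableC.
  - by apply: measurableU => //; exact: measurableU.
  - move=> x nF; have [Ax|Ax] := pselect (A x); last first.
      by left; split=> // gx; apply: nF; exact: sx.
    by right; have [Rx|Rx] := pselect (reach g l x); [right|left].
have := mass_setU mZ (measurableU _ _ mY mX); have := mass_setU mY mX.
by have := mass_ge0 E; rewrite -/E; lra.
Qed.

Lemma approx_by_tfg g g' (d : R) : homeo_pair g g' ->
    (forall x, exists n, g x = iterz T n x) ->
    (forall n, exists i, e i = n) -> 0 < d ->
  exists2 s, in_tfg T s & mass (~` agree (s \o g) id) < d.
Proof.
move=> hg orbg esurj d0.
pose S := [set r | exists2 s, in_tfg T s & r = mass (~` agree (s \o g) id)].
have S0 : S !=set0.
  by exists (mass (~` agree (id \o g) id)), id => //; exact: in_tfg_id.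
have lbS : has_lbound S by exists 0 => _ [s _ ->]; exact: mass_ge0.
have [lt_d|ge_d] := ltP (inf S) d.
  have d'0 : 0 < d - inf S by lra.
  have [_ [s sT ->] sd] := inf_adherent d'0 (conj S0 lbS).
  by exists s => //; lra.
(* If inf S > 0, the factor 1/10 works since 3/4 * (1 + 1/10) + 1/10 < 1. *)
have i0 : 0 < inf S / 10 by lra.
have [_ [s sT ->] sd] := inf_adherent i0 (conj S0 lbS).
have [s' [n [hs _ sn]]] := sT.
have [|t tT] := shrink_unfixed (homeo_pair_comp hs hg) _ i0.
  move=> x; have [k gx] := orbg x; have [i ei] := esurj (n (g x) + k).
  by exists i; rewrite ei iterzD -gx -sn.
have : inf S <= mass (~` agree (t \o (s \o g)) id).
  by apply: ge_inf => //; exists (t \o s) => //; exact: in_tfg_comp.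
by lra.
Qed.

End separation.

(** * Density of the topological full group *)

Section density.
Context {R : realType} {X : pseudoPMetricType R}.

(** To compare orbits, it suffices to compare one step. *)
Lemma iterz_orbit (S T : borel_aut X) :
    (forall x, exists n, S x = iterz T n x) ->
  forall x, baut_orbit S x `<=` baut_orbit T x.
Proof.
move=> ST x _ [n _ <-].
suff [k ->] : exists k, iterz S n x = iterz T k x by exists k.
elim/int_ind: n => [|n [k IH]|n [k IH]]; first by exists 0.
  have [j Sj] := ST (iterz S n x); exists (j + k).
  by rewrite intS addrC iterzS Sj IH iterzD.
rewrite intS opprD addrC iterzN1 IH.
have [j] := ST (baut_inv S (iterz T k x)); rewrite baut_invK => Sj.
by exists (- j + k); rewrite iterzD [in RHS]Sj iterzK.
Qed.

Lemma clopen_separating : cantor_like X -> exists2 V : nat -> set X,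
  forall i, clopen (V i) & forall x y, (forall i, V i x <-> V i y) -> x = y.
Proof.
move=> [_ cptX _ zdX]; pose V := unsquash (clopen_surj cptX).
exists V => [i|x y xy]; first by apply: (@funS _ _ _ _ V).
apply: contrapT => /eqP /zdX [U [cU Ux Uy]].
have [i _ ViU] : exists2 i, [set: nat] i & V i = U.
  by have /= := @surj _ _ _ _ V => /(_ U cU) [i iT ViU]; exists i.
by apply: Uy; rewrite -ViU; apply/xy; rewrite ViU.
Qed.

Lemma tfg_approx (T S : borel_aut X) (mus : seq (probability (borel X) R))
    (d : R) : cantor_like X -> homeo_pair T (baut_inv T) ->
    homeo_pair S (baut_inv S) -> (forall x, exists n, S x = iterz T n x) ->
    0 < d ->
  exists s s' (n : X -> discrete_topology int), [/\ homeo_pair s s',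
    continuous n, forall x, s x = iterz T (n x) x &
    forall mu, mu \in mus -> (mu [set x | s x <> S x] < d%:E)%E].
Proof.
move=> cantorX homT homS orbS d0.
have [V cV sepV] := clopen_separating cantorX.
(* x0 is only the default value of nth. *)
pose x0 : probability (borel X) R := dirac (point : borel X).
pose nu : {measure set (borel X) -> \bar R} :=
  msum (fun i => nth x0 mus i) (size mus).
have nuE A : nu A = (\sum_(i < size mus) (nth x0 mus i : set _ -> _) A)%E by [].
have nuT : (nu setT < +oo)%E.
  rewrite nuE; apply: lte_sum_pinfty => i _.
  by apply: (@le_lt_trans _ _ 1%:E); rewrite ?ltry// probability_le1.
pose e i : int := odflt 0 (unpickle i).
have esurj n : exists i, e i = n by exists (pickle n); rewrite /e pickleK.
have [s sT sd] := approx_by_tfg cV sepV nuT homT homS orbS esurj d0.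
have [s' [k [hs lk sk]]] := sT; have [sK s'K cs cs'] := hs.
have [t [n [ht ln tn]]] := in_tfg_inv sT sK; have [s'K' _ cs'' _] := ht.
exists s', t, n; split=> //; first exact/continuous_discreteP.
move=> mu mumus; have [_ _ cS _] := homS.
have cid : continuous (@id X) by move=> x; exact: cvg_id.
have cC : measurable (~` agree s' S : set (borel X)).
  by apply: measurableC; apply: measurable_agree.
have [_ _ csS _] := homeo_pair_comp hs homS.
have mF : measurable (~` agree (s \o S) id : set (borel X)).
  by apply: measurableC; apply: measurable_agree.
apply: (@le_lt_trans _ _ (nu (~` agree (s \o S) id))).
  apply: (@le_trans _ _ (mu (~` agree (s \o S) id))).
    apply: le_measure; rewrite ?inE//.
    by move=> x /= nsx sSx; apply: nsx; move/(congr1 s'): sSx; rewrite /= sK.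
  have iz : (index mu mus < size mus)%N by rewrite index_mem.
  rewrite nuE (bigD1 (Ordinal iz))//= nth_index//.
  by rewrite leeDl//; apply: sume_ge0.
by rewrite -(fineK (nu_fin nuT mF)) lte_fin.
Qed.

End density.

Theorem corollary2p3 (R : realType) (X : pseudoPMetricType R)
    (cantorX : cantor_like X) (T : homeo X) :
  dense (set_val @^-1` topological_full_group T : set (full_group T)).
Proof.
move=> W [P WP] [W1 [W2 oW2 e2] e1].
pose S : borel_aut X := set_val (set_val P).
have W2S : W2 S by move: WP; rewrite -e1 -e2.
have [_ /(_ S W2)] := uniform_base_basis cantorX.
case; first exact: open_nbhs_nbhs.
move=> U [[T0 [mus [c [c0 UE]]]] US] UW2.
move: US; rewrite UE => /(uniform_nbhd_sub cantorX)[d d0 dU].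
have [cT cT'] := set_valP T; have [cS cS'] := set_valP (set_val P).
have orbS x : exists n, S x = iterz (set_val T) n x.
  by have [|n _ <-] := set_valP P x (S x); [exists 1|exists n].
have hT : homeo_pair (set_val T) (baut_inv (set_val T)).
  by split=> //; [exact: baut_funK|exact: baut_invK].
have hS : homeo_pair S (baut_inv S).
  by split=> //; [exact: baut_funK|exact: baut_invK].
have [s [s' [n [[sK s'K cs cs'] cn sn smu]]]] :=
  tfg_approx mus cantorX hT hS orbS d0.
pose Q := baut_of_homeo sK s'K cs cs'.
have homQ : Q \in homeo X by rewrite inE.
pose Q1 : homeo X := exist _ Q homQ.
have fgQ : full_group T Q1.
  by apply: iterz_orbit => x; exists (n x); exact: sn.
pose Q2 : full_group T := exist _ Q1 (mem_set fgQ).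
exists Q2; split; last by split=> //; exists n.
rewrite -e1 /= -e2 /=; apply: UW2; rewrite UE; apply: dU => mu mumus.
exact: smu.
Qed.
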